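(* Let $\gamma$ be a smooth strictly convex closed curve in the Euclidean plane. For integers $p,q\ge1$ with $2p<q$ let $S_{p,q}$ be the minimal perimeter of the $q$-gons with rotation number $p$ circumscribed about $\gamma$. Then for all relatively prime positive integers $p,q$ with $2p<q-1$, $$S_{p,q-1}+S_{p,q+1}>2S_{p,q}.$$
   Context: Orient $\gamma$ counterclockwise and for $\theta\in\mathbb{R}$ let $\gamma(\theta)$ be the point of $\gamma$ whose oriented tangent line $\ell(\theta)$ has direction $(\cos\theta,\sin\theta)$; so $\gamma(\theta+2\pi)=\gamma(\theta)$. A circumscribed $q$-gon with rotation number $p$ is given by real numbers $\theta_0\le\theta_1\le\dots\le\theta_q=\theta_0+2\pi p$ with $0\le\theta_{i+1}-\theta_i<\pi$; its vertices are $A_i=\ell(\theta_i)\cap\ell(\theta_{i+1})$, $i=0,\dots,q-1$ (with $A_i=\gamma(\theta_i)$ if $\theta_{i+1}=\theta_i$), in cyclic order. It may be star-shaped. Its perimeter is $\sum_{i}|A_iA_{i+1}|$, indices mod $q$ (equivalently $\sum_i(|\gamma(\theta_i)A_i|+|A_i\gamma(\theta_{i+1})|)$). The integers $p,q$ in the definition of $S_{p,q}$ need not be relatively prime. *)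

(* Defs.v *)
From HB Require Import structures.
From mathcomp Require Import all_boot all_order all_algebra.
From mathcomp Require Import all_classical all_reals all_analysis.
Set Implicit Arguments.
Unset Strict Implicit.
Unset Printing Implicit Defensive.
Import Order.TTheory GRing.Theory Num.Theory.
Import numFieldNormedType.Exports.
Local Open Scope classical_set_scope.
Local Open Scope ring_scope.

Section CircumscribedPolygons.
Variable R : realType.
Implicit Types (P Q u v : R * R) (c : R -> R * R) (a b : R).

Definition det2 u v : R := u.1 * v.2 - u.2 * v.1.

(* The norm that the library puts on [R * R] is the max norm. *)
Definition edist P Q : R :=
  Num.sqrt ((P.1 - Q.1) ^+ 2 + (P.2 - Q.2) ^+ 2).

(* A [T]-periodic, C^oo, regular and simple parametrization. The last clause
   is strict convexity together with the counterclockwise orientation: each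
   oriented tangent line has the curve strictly on its left, except for the
   point of tangency. The curvature is allowed to vanish. *)
Definition smooth_strictly_convex_closed (T : R) c : Prop :=
  [/\ 0 < T /\ (forall t, c (t + T) = c t),
      forall n t, derivable (derive1n n c) t 1,
      forall t, derive1 c t != 0,
      {in `[0, T[ &, injective c} &
      forall s t, c s != c t -> 0 < det2 (derive1 c t) (c s - c t)].

Definition direction a : R * R := (cos a, sin a).

(* [gamma(a)]; there is exactly one such point on a curve as above. *)
Definition tangency c a : R * R :=
  get [set P | exists t, P = c t /\
                 exists2 r, 0 < r & derive1 c t = r *: direction a].

Definition tangent_line c a : set (R * R) :=
  [set tangency c a + r *: direction a | r in [set: R]].

(* When [0 < b - a < pi] the two lines meet in exactly one point. *)
Definition vertex c a b : R * R :=
  if a == b then tangency c a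
  else get (tangent_line c a `&` tangent_line c b).

(* Only the values [th 0], ..., [th q] matter. *)
Definition circumscribed (p q : nat) (th : nat -> R) : Prop :=
  (forall i, (i < q)%N -> 0 <= th i.+1 - th i < pi) /\
  th q = th 0%N + 2 * pi * p%:R.

Definition perimeter c (q : nat) (th : nat -> R) : R :=
  let A i := vertex c (th i) (th i.+1) in
  \sum_(i < q) edist (A i) (A (i.+1 %% q)%N).

Definition perimeters c (p q : nat) : set R :=
  [set perimeter c q th | th in circumscribed p q].

Definition min_perimeter c (p q : nat) : R :=
  get (perimeters c p q `&` lbound (perimeters c p q)).

End CircumscribedPolygons.

(* Main.v *)
(* Let [h] be the support function of the curve about an interior point. The
   perimeter of the circumscribed polygon with tangent angles [th i] is the sum
   of the [G (th i) (th i.+1)], where [G a b = (h a + h b) * tan ((b - a) / 2)]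
   has a negative mixed derivative. So the sum of [G] decreases when two nested
   edges [(a, b')] and [(a', b)], [a <= a' <= b <= b'], are replaced by [(a, b)]
   and [(a', b')]. Superimposed shortest polygons with [q - 1] and [q + 1] sides
   have two pairs of nested edges, and replacing both pairs leaves two [q]-gons
   with the same rotation number. If no length is gained, one of these is a
   shortest [q]-gon which shares a tangent line and its predecessor, but not its
   successor, with the shortest [(q + 1)]-gon; since [G] is differentiable, that
   line cannot be optimally placed for both. *)
Require Import Defs.
From mathcomp Require Import all_boot all_order all_algebra.
From mathcomp Require Import all_classical all_reals all_analysis.
From mathcomp Require Import ring lra zify.
Set Implicit Arguments.
Unset Strict Implicit.
Unset Printing Implicit Defensive.
Import Order.TTheory GRing.Theory Num.Theory.
Import numFieldNormedType.Exports.
Local Open Scope classical_set_scope.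
Local Open Scope ring_scope.

(** * Combinatorics of nested edges *)

Section Chains.
Variables (R : realType) (w C : R) (G : R -> R -> R).
Implicit Types (x y z u v : nat -> R) (n d k i m : nat) (a b s t : R).

(* A circumscribed [n]-gon unrolled to an infinite sequence of tangent angles;
   in the application [w] is [pi] and [C] is [2 * pi * p]. *)
Definition chain n x : Prop :=
  (forall i, 0 <= x i.+1 - x i < w) /\ (forall i, x (i + n)%N = x i + C).

(** With [w = pi] and [C = 2 * pi * p] this is [circumscribed p n]; gluing pieces of two chains
    yields this finite form. *)
Definition closed_chain n x : Prop :=
  (forall i, (i < n)%N -> 0 <= x i.+1 - x i < w) /\ x n = x 0%N + C.

Definition chain_length n x : R := \sum_(0 <= i < n) G (x i) (x i.+1).

Definition minimal_chain n x : Prop :=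
  chain n x /\ forall y, chain n y -> chain_length n x <= chain_length n y.

Lemma chain_closed n x : chain n x -> closed_chain n x.
Proof. by move=> [x1 x2]; split=> [i _|]; [exact: x1|rewrite -x2 add0n]. Qed.

Lemma chain_le n x i j : chain n x -> (i <= j)%N -> x i <= x j.
Proof.
move=> [x1 _] /subnK <-; elim: (j - i)%N => [//|m IH].
by rewrite addSn; move: (x1 (m + i)%N); lra.
Qed.

Lemma chain_mulD n x i m : chain n x -> x (i + m * n)%N = x i + m%:R * C.
Proof.
move=> [_ x2]; elim: m => [|m IH]; first by rewrite mul0n addn0 mul0r addr0.
by rewrite mulSn addnA addnAC x2 IH -natr1; ring.
Qed.

Lemma chain_shift n x i : chain n x -> chain n (fun m => x (i + m)%N).
Proof.
by move=> [x1 x2]; split=> m; [rewrite addnS; exact: x1|rewrite addnA x2].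
Qed.

Definition unroll n x i : R := x (i %% n)%N + (i %/ n)%:R * C.

Lemma unroll_small n x i : closed_chain n x -> (0 < n)%N -> (i <= n)%N ->
  unroll n x i = x i.
Proof.
move=> [_ x2] n0; rewrite leq_eqVlt => /predU1P[->|lt_in]; rewrite /unroll.
  by rewrite modnn divnn n0 mul1r x2.
by rewrite modn_small // divn_small // mul0r addr0.
Qed.

Lemma unroll_chain n x : closed_chain n x -> (0 < n)%N ->
  chain n (unroll n x).
Proof.
move=> hx n0; have per i : unroll n x (i + n)%N = unroll n x i + C.
  by rewrite /unroll modnDr divnDr ?dvdnn // divnn n0 /= addn1 -natr1; ring.
have perM i m : unroll n x (m * n + i)%N = unroll n x i + m%:R * C.
  elim: m => [|m IH]; first by rewrite mul0n add0n mul0r addr0.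
  by rewrite mulSn -addnA addnC per IH -natr1; ring.
split=> // i; rewrite (divn_eq i n) -addnS !perM.
have lt_in := ltn_pmod i n0.
rewrite !unroll_small //; last exact: ltnW.
by case: hx => /(_ _ lt_in) + _; lra.
Qed.

Lemma unroll_length n x : closed_chain n x -> (0 < n)%N ->
  chain_length n (unroll n x) = chain_length n x.
Proof.
move=> hx n0; apply: eq_big_nat => i /andP[_ lt_in].
by rewrite !unroll_small // ltnW.
Qed.

Lemma minimal_closed n x y : (0 < n)%N -> minimal_chain n x ->
  closed_chain n y -> chain_length n x <= chain_length n y.
Proof.
move=> n0 [_ hx] hy; rewrite -(unroll_length hy n0).
exact: hx (unroll_chain hy n0).
Qed.

Hypothesis G_shift : forall a b, G (a + C) (b + C) = G a b.

(** Advancing the window by one index drops its first edge and appends the translate of that edge by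
    [C]. *)
Lemma chain_length_shift n x i : chain n x ->
  chain_length n (fun m => x (i + m)%N) = chain_length n x.
Proof.
move=> hx; elim: i => [//|i <-].
case: n hx => [|n] hx; first by rewrite /chain_length !big_geq.
rewrite /chain_length [LHS]big_nat_recr //= [RHS]big_nat_recl //= addrC.
congr (_ + _); last first.
  by apply: eq_big_nat => m _; rewrite !addSnnS.
case: hx => _ x2; rewrite -[in RHS]G_shift -!x2 !addnS addn0.
by congr G; congr x; lia.
Qed.

Lemma minimal_shift n x i : minimal_chain n x ->
  minimal_chain n (fun m => x (i + m)%N).
Proof.
move=> [hx mx]; split; first exact: chain_shift.
by move=> y hy; rewrite chain_length_shift //; exact: mx.
Qed.

(** A shift brings the moved angle to index 1, which for [1 < n] is neither [0] nor [n], so that it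
    can vary freely. *)
Lemma minimal_vertex n x m t : (1 < n)%N -> minimal_chain n x ->
    x m <= t <= x m.+2 -> t < x m + w -> x m.+2 < t + w ->
  G (x m) (x m.+1) + G (x m.+1) (x m.+2) <= G (x m) t + G t (x m.+2).
Proof.
case: n => [|[|n]] // _ /(minimal_shift m) mx t1 t2 t3.
pose z i := if i == 1 then t else x (m + i)%N.
have hz : closed_chain n.+2 z.
  have [[x1 x2] _] := mx; split; last by rewrite /z /= -(x2 0%N) add0n.
  move=> i _; rewrite /z; case: i => [|[|i]] /=; last exact: x1.
    by rewrite addn0; lra.
  by rewrite addn2; lra.
have := @minimal_closed n.+2 _ _ isT mx hz.
rewrite /chain_length !big_nat_recl //= /z /= addn0 addn1 addn2.
by rewrite !addrA lerD2r.
Qed.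

Hypothesis G_diag : forall a, G a a = 0.
Hypothesis monge : forall a a' b b', a <= a' -> a' <= b -> b <= b' ->
  b' < a + w -> G a b + G a' b' <= G a b' + G a' b.
Hypothesis monge_strict : forall a a' b b', a < a' -> a' <= b -> b < b' ->
  b' < a + w -> G a b + G a' b' < G a b' + G a' b.
(* The optimal position of a vertex with a fixed predecessor moves when its
   successor does. *)
Hypothesis no_corner : forall a t b b', a < t -> t < b -> b < b' ->
  t < a + w -> b' < t + w ->
  (forall s, a < s < b -> s < a + w -> b' < s + w ->
    G a t + G t b <= G a s + G s b) ->
  (forall s, a < s < b -> s < a + w -> b' < s + w ->
    G a t + G t b' <= G a s + G s b') -> False.
Hypothesis C_gt0 : 0 < C.

(** A repeated angle contributes nothing by [G_diag]; moving one copy to the middle of a proper edge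
    next to it saves length by [monge_strict]. *)
Lemma minimal_lt n x m : (1 < n)%N -> minimal_chain n x -> x m < x m.+1.
Proof.
move=> n1 mx; have hx := mx.1; have [x1 x2] := hx.
rewrite lt_neqAle (chain_le hx (leqnSn m)) andbT; apply/negP => /eqP eqm.
(* Otherwise [x] would be constant from [m] on, contrary to [x (m + n) = x m + C]. *)
have [l ml ltl] : exists2 l, (m <= l)%N & x l < x l.+1.
  apply: contrapT => noP.
  have cst k : x (m + k)%N = x m.
    elim: k => [|k IH]; first by rewrite addn0.
    rewrite addnS; have := x1 (m + k)%N.
    rewrite subr_ge0 le_eqVlt => /andP[/predU1P[<-//|lt1] _].
    by case: noP; exists (m + k)%N; rewrite ?leq_addr.
  by have := x2 m; move: C_gt0; rewrite cst => ? ?; lra.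
(* Going down from [l], the first repetition met is directly followed by a strict step. *)
have [k [eqk ltk]] : exists k, x k = x k.+1 /\ x k.+1 < x k.+2.
  elim: l ml ltl => [|l IH].
    by rewrite leqn0 => /eqP m0; rewrite -m0 -eqm ltxx.
  rewrite leq_eqVlt => /predU1P[<-|ml ltl]; first by rewrite -eqm ltxx.
  have := x1 l; rewrite subr_ge0 le_eqVlt => /andP[/predU1P[eql _|/(IH ml)//]].
  by exists l.
have st2 := x1 k.+1.
pose t := (x k.+1 + x k.+2) / 2.
have := @minimal_vertex n x k t n1 mx.
rewrite eqk G_diag /t => /(_ _ _ _).
have /(_ _ _ _ _) := @monge_strict (x k.+1) t t (x k.+2).
by rewrite G_diag /t; lra.
Qed.

(** * Exchange of nested edges *)

Definition splice k x y i : R := if (i <= k)%N then x i else y i.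

Lemma splice_length k n x y : (k < n)%N ->
  chain_length n (splice k x y) =
  chain_length k x + G (x k) (y k.+1) +
  \sum_(k.+1 <= i < n) G (y i) (y i.+1).
Proof.
move=> kn; rewrite /chain_length.
rewrite (@big_cat_nat _ _ _ k 0 n _ _ isT (ltnW kn)) //=.
rewrite [X in _ + X]big_ltn // addrA; congr (_ + _ + _).
- apply: eq_big_nat => i /andP[_ ik].
  by rewrite /splice ik (ltnW ik).
- by rewrite /splice leqnn ltnn.
- apply: eq_big_nat => i /andP[ki _].
  by rewrite /splice leqNgt ki leqNgt (ltn_trans ki).
Qed.

Lemma big_nat_split3 (F : nat -> R) d n : (0 < d)%N -> (d < n)%N ->
  \sum_(0 <= i < n) F i =
  F 0%N + \sum_(0 <= i < d.-1) F i.+1 + F d + \sum_(d.+1 <= i < n) F i.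
Proof.
case: d => // d _ dn.
rewrite (@big_cat_nat _ _ _ d.+1 0 n _ _ isT (ltnW dn)) //= big_nat_recl //.
by rewrite [X in _ + X]big_ltn // !addrA.
Qed.

(* [z1] and [z2] arise from exchanging the nested edges [(u 0, u 1)] and
   [(v 0, v 1)], and then [(u d, u d.+1)] and [(v d.+1, v d.+2)]. *)
Lemma uncross n u v d : (0 < d)%N -> (d < n)%N ->
    chain n u -> chain n.+2 v -> u 0%N <= v 0%N -> u d <= v d.+1 ->
    (forall m, (0 < m)%N -> v m < u m) ->
    (forall m, (d < m)%N -> v m.+1 < u m) ->
  exists z1 z2,
    [/\ closed_chain n.+1 z1, closed_chain n.+1 z2,
        chain_length n.+1 z1 + chain_length n.+1 z2 +
          (G (u 0) (u 1) + G (v 0) (v 1) - G (u 0) (v 1) - G (v 0) (u 1)) +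
          (G (u d) (u d.+1) + G (v d.+1) (v d.+2)
           - G (u d) (v d.+2) - G (v d.+1) (u d.+1)) =
        chain_length n u + chain_length n.+2 v &
        z1 0%N = u 1 /\ z1 n = v n.+2 /\ z1 n.-1 = v n.+1].
Proof.
case: d => // e _ en hu hv uv0 uvd vu1 vud.
have [u1 u2] := hu; have [v1 v2] := hv.
have eqn1 : u n.+1 = u 1 + C by rewrite -u2 add1n.
have eqn2 : v n.+2 = v 0 + C by rewrite -v2.
have eqn3 : v n.+3 = v 1 + C by rewrite -v2 add1n.
have eqn0 : u n = u 0 + C by rewrite -u2.
(* With [d = e.+1], [z1] is [u 1, ..., u d, v d.+2, ..., v n.+2], closed by [u n.+1], and [z2] is
   [v 1, ..., v d.+1, u d.+1, ..., u n], closed by [v n.+3]. *)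
exists (splice n (splice e (fun m => u m.+1) (fun m => v m.+2)) u).
exists (splice n (splice e.+1 (fun m => v m.+1) u) (fun m => v m.+2)).
split=> //.
(* Each new edge lies inside the outer edge of its nested pair, hence spans less than [w]. *)
- split; last by rewrite /splice ltnn /= eqn1.
  move=> i iN; rewrite /splice.
  have [ie|ie|ie] := ltngtP i e.
  + have -> : (i <= n)%N by lia.
    by have -> : (i < n)%N by lia.
  + have -> : (i <= n)%N by lia.
    have [in_|in_] := ltnP i n; first exact: v1.
    have -> : i = n by lia.
    have := u1 0%N; have := vu1 1 isT; have := v1 0%N.
    by rewrite eqn1 eqn2; lra.
  + rewrite ie; have -> : (e <= n)%N by lia.
    have -> : (e < n)%N by lia.
    have := u1 e.+1; have := vud e.+2 (leqnn _); have := v1 e.+2.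
    lra.
- split; last by rewrite /splice ltnn /= eqn3.
  move=> i iN; rewrite /splice.
  have [ie|ie|ie] := ltngtP i e.+1.
  + have -> : (i <= n)%N by lia.
    by have -> : (i < n)%N by lia.
  + have -> : (i <= n)%N by lia.
    have [in_|in_] := ltnP i n; first exact: u1.
    have -> : i = n by lia.
    have := u1 0%N; have := vu1 1 isT; have := v1 0%N.
    by rewrite eqn0 eqn3; lra.
  + rewrite ie; have -> : (e < n)%N by lia.
    rewrite en.
    have := u1 e.+1; have := vud e.+2 (leqnn _); have := v1 e.+2.
    lra.
- rewrite !splice_length // /chain_length.
  rewrite [X in _ = X + _](@big_nat_split3 _ e.+1) //.
  rewrite [X in _ = _ + X](@big_nat_split3 _ e.+2) //; last lia.
  rewrite [X in _ = _ + (_ + X)]big_add1 big_add1 /splice eqn3 eqn1.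
  have -> : (n <= e)%N = false by lia.
  rewrite (leqNgt n) en /= !(@big_geq _ _ _ n.+1) // eqn0 eqn2 !G_shift.
  ring.
- lia.
- rewrite /splice leqnn leq_pred /=.
  have -> : (n <= e)%N = false by lia.
  have -> : (n.-1 <= e)%N = false by lia.
  by do 2!split=> //; congr v; lia.
Qed.

(* The case [d = 0], in which the edge [(u 0, u 1)] takes part in both
   exchanges. *)
Lemma uncross_same_edge n u v : (0 < n)%N ->
    chain n u -> chain n.+2 v -> u 0%N <= v 0%N ->
    (forall m, v m.+1 < u m.+1) -> v 2 < u 1 ->
  exists z1 z2,
    [/\ closed_chain n.+1 z1, closed_chain n.+1 z2 &
        chain_length n.+1 z1 + chain_length n.+1 z2 +
          (G (u 0) (u 1) + G (v 0) (v 1) - G (u 0) (v 1) - G (v 0) (u 1)) +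
          (G (v 0) (u 1) + G (v 1) (v 2) - G (v 0) (v 2) - G (v 1) (u 1)) =
        chain_length n u + chain_length n.+2 v].
Proof.
move=> n0 hu hv uv0 vu1 v2u1.
have [u1 u2] := hu; have [v1 v2] := hv.
have eqn2 : v n.+2 = v 0 + C by rewrite -v2.
have eqn3 : v n.+3 = v 1 + C by rewrite -v2 add1n.
have eqn4 : v n.+4 = v 2 + C by rewrite -v2 add2n.
have eqn0 : u n = u 0 + C by rewrite -u2.
(* [z1] is [v] without the angle [v 1]; [z2] is [u] with [v 1] inserted between [u 0] and [u 1]. *)
exists (splice n (fun m => v m.+2) (fun m => v m.+3)).
exists (splice n (splice 0 (fun m => v m.+1) u) (fun m => v m.+2)); split.
- split; last by rewrite /splice ltnn /= eqn4.
  move=> i; rewrite ltnS /splice => iN; rewrite iN.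
  have [in_|in_] := ltnP i n; first exact: v1.
  have -> : i = n by apply/eqP; rewrite eqn_leq iN.
  rewrite eqn2 eqn4.
  have w0 := u1 0%N; have w1 := v1 0%N; have w2 := v1 1; lra.
- split; last by rewrite /splice ltnn /= eqn3.
  move=> i; rewrite ltnS /splice => iN; rewrite iN.
  case: i iN => [|i] iN.
    rewrite n0 /=; have w0 := u1 0%N; have w1 := v1 0%N; have w2 := v1 1; lra.
  have [in_|in_] := ltnP i.+1 n; first exact: u1.
  have -> : i.+1 = n by apply/eqP; rewrite eqn_leq iN.
  rewrite leqNgt n0 /= eqn0 eqn3.
  have w0 := u1 0%N; have w1 := v1 0%N; have w2 := v1 1; lra.
- rewrite !splice_length // /chain_length.
  rewrite (@big_nat_recl _ _ _ n.+1) // (@big_nat_recl _ _ _ n) //.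
  rewrite [X in _ = X + _](@big_ltn _ _ _ 0) //.
  rewrite !(@big_geq _ _ _ n.+1) // /splice.
  have -> : (n <= 0)%N = false by rewrite leqNgt n0.
  rewrite /= !(@big_geq _ _ _ 0 0) //.
  by rewrite eqn0 eqn2 eqn3 eqn4 !G_shift; ring.
Qed.

(** * Crossings of two superimposed chains *)

Lemma chain_overtake n x y k : (0 < n)%N -> chain n x -> chain n.+2 y ->
  exists N, forall i, x i <= y (i + k)%N -> (i <= N)%N.
Proof.
(* Over [M] indices [x] advances by [n.+2] times [C] and [y] only by [n] times [C], so [x] finally
   overtakes any shift of [y]. *)
move=> n0 hx hy; pose M := (n * n.+2)%N.
have M0 : (0 < M)%N by rewrite muln_gt0 n0.
pose B := Num.bound (`|(y (M + k)%N - x 0%N) / C|).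
exists (B * M)%N => i; apply: contraTT; rewrite -ltnNge -ltNge => Bi.
rewrite (divn_eq i M); set m := (i %/ M)%N; set r := (i %% M)%N.
have Bm : (B <= m)%N by rewrite leq_divRL // ltnW.
have lex : x 0%N + (m * n.+2)%:R * C <= x (m * M + r)%N.
  rewrite -(chain_mulD _ _ hx) add0n; apply: (chain_le hx).
  by rewrite /M -mulnA [(n.+2 * n)%N]mulnC leq_addr.
have ley : y (m * M + r + k)%N <= y (M + k)%N + (m * n)%:R * C.
  rewrite -(chain_mulD _ _ hy); apply: (chain_le hy).
  by have := ltn_pmod i M0; rewrite -/r /M -mulnA; lia.
apply: le_lt_trans ley (lt_le_trans _ lex).
have : (y (M + k)%N - x 0%N) / C < m%:R.
  apply: le_lt_trans (ler_norm _) (lt_le_trans (archi_boundP _) _) => //.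
  by rewrite ler_nat.
rewrite ltr_pdivrMr // !natrM -addn2 natrD => lt1.
have := mulr_ge0 (ler0n R m) (ltW C_gt0); lra.
Qed.

(* Per period, [y] needs two indices more than [x]. So the last [i] with
   [x i <= y (i + k)] is nondecreasing in [k] and grows by exactly [n] when [k]
   grows by 2; hence it grows by less than [n] from [k] to [k.+1] for one of two
   consecutive [k]. *)
Lemma chain_crossing n x y : (0 < n)%N -> chain n x -> chain n.+2 y ->
  exists i k d, let u m := x (i + m)%N in let v m := y (i + k + m)%N in
  [/\ (d < n)%N, u 0%N <= v 0%N, u d <= v d.+1,
      forall m, (0 < m)%N -> v m < u m & forall m, (d < m)%N -> v m.+1 < u m].
Proof.
move=> n0 hx hy.
(* From this [K] on the index [0] satisfies the inequality, so that there is a last such index. *)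
have [K xyK] : exists K, x 0%N <= y K.
  pose B := Num.bound (`|(x 0%N - y 0%N) / C|); exists (B * n.+2)%N.
  rewrite -[(B * _)%N]add0n (chain_mulD _ _ hy).
  have : (x 0%N - y 0%N) / C < B%:R.
    exact: le_lt_trans (ler_norm _) (archi_boundP _).
  by rewrite ltr_pdivrMr //; lra.
have last k : (K <= k)%N -> exists i, x i <= y (i + k)%N /\
    forall m, (i < m)%N -> y (m + k)%N < x m.
  move=> Kk; have [N hN] := chain_overtake k n0 hx hy.
  have ex0 : exists i, x i <= y (i + k)%N.
    by exists 0%N; rewrite (le_trans xyK) // (chain_le hy).
  case: (ex_maxnP ex0 hN) => i xi imax; exists i; split=> // m im.
  by rewrite ltNge; apply/negP => /imax; rewrite leqNgt im.
have [i0 [xi0 lt0]] := last K (leqnn _).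
have [i1 [xi1 lt1]] := last K.+1 (leqnSn _).
have i01 : (i0 <= i1)%N.
  rewrite leqNgt; apply/negP => /lt1; apply/negP; rewrite -leNgt.
  by apply: le_trans xi0 (chain_le hy _); rewrite leq_add2l.
(* By periodicity the last index for [K.+2] is at most [i0 + n]. *)
have lt2 m : (i0 + n < m)%N -> y (m + K.+2)%N < x m.
  move=> im; have -> : m = (m - n + n)%N by lia.
  have -> : (m - n + n + K.+2 = m - n + K + n.+2)%N by lia.
  case: hx hy => _ -> [_ ->]; rewrite ltrD2r; apply: lt0; lia.
(* If the last index grows by less than [n] from [K] to [K.+1], take [d = i1 - i0]. *)
have [i1n|ni1] := ltnP i1 (i0 + n).
  exists i0, K, (i1 - i0)%N; split.
  - by lia.
  - by rewrite !addn0.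
  - have -> : (i0 + (i1 - i0) = i1)%N by lia.
    by have -> : (i0 + K + (i1 - i0).+1 = i1 + K.+1)%N by lia.
  - move=> m m0; rewrite addnAC; apply: lt0; lia.
  - move=> m im; have -> : (i0 + K + m.+1 = i0 + m + K.+1)%N by lia.
    by apply: lt1; lia.
(* Otherwise it does not grow at all from [K.+1] to [K.+2], which gives [d = 0]. *)
have lt2' m : (i1 < m)%N -> y (m + K.+2)%N < x m.
  by move=> i1m; apply: lt2; exact: leq_ltn_trans ni1 i1m.
exists i1, K.+1, 0%N; split=> //.
- by rewrite !addn0.
- rewrite addn0 (le_trans xi1) // (chain_le hy) //; lia.
- move=> m m0; rewrite addnAC; apply: lt1; lia.
- move=> m m0; have -> : (i1 + K.+1 + m.+1 = i1 + m + K.+2)%N by lia.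
  by apply: lt2'; lia.
Qed.

Theorem minimal_chain_convex n x y z : (0 < n)%N ->
    minimal_chain n x -> minimal_chain n.+2 y -> minimal_chain n.+1 z ->
  2 * chain_length n.+1 z < chain_length n x + chain_length n.+2 y.
Proof.
move=> n0 mx my mz.
have [i [k [d]]] := chain_crossing n0 mx.1 my.1.
set u := fun m => x (i + m)%N; set v := fun m => y (i + k + m)%N.
move=> [dn uv0 uvd vu vud].
have mu : minimal_chain n u := minimal_shift i mx.
have mv : minimal_chain n.+2 v := minimal_shift (i + k) my.
rewrite -(chain_length_shift i mx.1) -(chain_length_shift (i + k) my.1).
rewrite -/u -/v => {mx my}.
have [hu hv] := (mu.1, mv.1); have [u1 u2] := hu; have [v1 v2] := hv.
have minz z' : closed_chain n.+1 z' ->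
    chain_length n.+1 z <= chain_length n.+1 z' by exact: minimal_closed.
have [st0 st1] := (u1 0%N, v1 0%N).
have vu1 := vu 1 isT.
have swap0 : G (u 0) (v 1) + G (v 0) (u 1) <= G (u 0) (u 1) + G (v 0) (v 1).
  by apply: monge; lra.
(* For [d = 0] the second exchange is strict because consecutive angles of the shortest [v]
   differ. *)
have [d0|d_gt0] := posnP d.
  rewrite d0 in vud.
  have v2u1 := vud 1 isT; have lt01 := minimal_lt 0 (isT : (1 < n.+2)%N) mv.
  have lt12 := minimal_lt 1 (isT : (1 < n.+2)%N) mv.
  have [z1 [z2 [hz1 hz2 eqz]]] : exists z1 z2, _ :=
    uncross_same_edge n0 hu hv uv0 (fun m => vu m.+1 isT) v2u1.
  have := minz _ hz1; have := minz _ hz2.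
  have : G (v 0) (v 2) + G (v 1) (u 1) < G (v 0) (u 1) + G (v 1) (v 2).
    by apply: monge_strict; lra.
  by lra.
have [z1 [z2 [hz1 hz2 eqz [z10 [z1n z1p]]]]] :=
  uncross d_gt0 dn hu hv uv0 uvd vu vud.
have := minz _ hz1; have := minz _ hz2.
have [[std0 std1] vud1] := (u1 d, v1 d.+1, vud d.+1 (leqnn _)).
have swapd : G (u d) (v d.+2) + G (v d.+1) (u d.+1) <=
    G (u d) (u d.+1) + G (v d.+1) (v d.+2).
  by apply: monge; lra.
(* If [u 0 < v 0], the first exchange is strict, as [v 1 < u 1]. *)
have [uv0_eq|uv0_neq] := eqVneq (u 0%N) (v 0%N); last first.
  have : G (u 0) (v 1) + G (v 0) (u 1) < G (u 0) (u 1) + G (v 0) (v 1).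
    by apply: monge_strict; [rewrite lt_neqAle uv0_neq| | |]; lra.
  by lra.
(* In case of equality [z1] is minimal as well; it follows [v] up to the vertex
   [v n.+2] but then turns to another successor than [v] does. *)
move=> le2 le1; rewrite ltNge; apply/negP => ge.
have nz1 : (0 < n.+1)%N by [].
pose X := unroll n.+1 z1.
have mX : minimal_chain n.+1 X.
  split; first exact: unroll_chain.
  move=> z' hz'; rewrite /X unroll_length //.
  by apply: le_trans (mz.2 _ hz'); lra.
have Xp : X n.-1 = v n.+1 by rewrite /X unroll_small // leqW ?leq_pred.
have Xn : X n.-1.+1 = v n.+2 by rewrite prednK // /X unroll_small.
have Xs : X n.-1.+2 = u 1 + C.
  by rewrite prednK // /X unroll_small // hz1.2 z10.
have v2C : v n.+2 = v 0 + C by rewrite -v2.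
have v3C : v n.+3 = v 1 + C by rewrite -v2 add1n.
have lt1 := minimal_lt n.+1 (isT : (1 < n.+2)%N) mv.
have lt2 := minimal_lt n.+2 (isT : (1 < n.+2)%N) mv.
have stv := v1 n.+1.
(* After [v n.+1] and [v n.+2], the chain [v] continues to [v 1 + C] but [X] to the larger
   [u 1 + C]. *)
apply: (@no_corner (v n.+1) (v n.+2) (v n.+3) (u 1 + C)); try lra.
- move=> s s1 s2 s3; apply: (minimal_vertex (isT : (1 < n.+2)%N) mv); lra.
- move=> s s1 s2 s3; rewrite -Xp -Xn -Xs.
  have := @minimal_vertex n.+1 X n.-1 s n0 mX; rewrite Xp Xs.
  by apply; lra.
Qed.

End Chains.

(** Negativity is asked in the open interval only: at a degenerate edge the tangent segments vanish,
    and with them the mixed derivative. *)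
Lemma derive_lt (R : realType) (f df : R -> R) (a b : R) : a < b ->
    (forall s, a <= s <= b -> is_derive s 1 f (df s)) ->
    (forall s, a < s < b -> df s < 0) -> f b < f a.
Proof.
move=> ab hf hdf.
have [||c] := @MVT R f df a b ab.
- by move=> x; rewrite in_itv /= => /andP[ax xb]; apply: hf; rewrite !ltW.
- apply: derivable_within_continuous => x; rewrite in_itv /= => xab.
  by case: (hf x xab).
- rewrite in_itv /= => /hdf df0 eqf; rewrite -subr_lt0 eqf.
  by rewrite nmulr_rlt0 // subr_gt0.
Qed.

(** * Perimeter in terms of the support function *)

Section SupportFunction.
Variables (R : realType) (h k : R -> R).
Implicit Types a b s t : R.
Hypothesis h_derive : forall a, is_derive a 1 h (k a).
Hypothesis h_periodic : forall a, h (a + 2 * pi) = h a.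
Hypothesis h_gt0 : forall a, 0 < h a.

Definition half_tan a b : R := tan ((b - a) / 2).

(* With [h] the support function and [k] its derivative, the tangent segments
   between the points of tangency and the vertex have total length
   [tangent_length a b + k b - k a]; the terms in [k] cancel around a closed
   polygon. *)
Definition tangent_length a b : R := (h a + h b) * half_tan a b.

(** The tangent segments have positive total length; this is how strict convexity enters. *)
Hypothesis tangents_gt0 : forall a b, a < b < a + pi ->
  0 < tangent_length a b + k b - k a.

Lemma cos_half_neq0 a b : a - pi < b < a + pi -> cos ((b - a) / 2) != 0.
Proof. by move=> ab; rewrite gt_eqF // cos_gt0_pihalf //; lra. Qed.

Lemma half_tan_derive_r a b : a - pi < b < a + pi ->
  is_derive b 1 (half_tan a) ((1 + half_tan a b ^+ 2) / 2).
Proof.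
move=> /cos_half_neq0 cn0.
have dt := is_derive_tan cn0.
have dl : is_derive b 1 (fun s : R => (s - a) / 2) (2^-1).
  by apply: is_derive_eq; rewrite /GRing.scale /=; field.
have := @is_derive1_comp _ tan (fun s => (s - a) / 2) b _ _ dt dl.
by rewrite cos2_tan2.
Qed.

Lemma half_tan_derive_l a b : b - pi < a < b + pi ->
  is_derive a 1 (half_tan^~ b) (- (1 + half_tan a b ^+ 2) / 2).
Proof.
move=> hab; have hab' : a - pi < b < a + pi by lra.
have dt := is_derive_tan (cos_half_neq0 hab').
have dl : is_derive a 1 (fun s : R => (b - s) / 2) (- 2^-1).
  by apply: is_derive_eq; rewrite /GRing.scale /=; field.
have := @is_derive1_comp _ tan (fun s => (b - s) / 2) a _ _ dt dl.
by rewrite cos2_tan2 ?cos_half_neq0 // mulrN mulNr.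
Qed.

Definition tangent_length_dl a b : R :=
  k a * half_tan a b - (h a + h b) * (1 + half_tan a b ^+ 2) / 2.

Definition tangent_length_dr a b : R :=
  k b * half_tan a b + (h a + h b) * (1 + half_tan a b ^+ 2) / 2.

Lemma tangent_length_derive_l a b : b - pi < a < b + pi ->
  is_derive a 1 (tangent_length^~ b) (tangent_length_dl a b).
Proof.
move=> /half_tan_derive_l dt; have dh := h_derive a.
rewrite /tangent_length; apply: is_derive_eq.
by rewrite /tangent_length_dl /GRing.scale /=; ring.
Qed.

Lemma tangent_length_derive_r a b : a - pi < b < a + pi ->
  is_derive b 1 (tangent_length a) (tangent_length_dr a b).
Proof.
move=> /half_tan_derive_r dt; have dh := h_derive b.
rewrite /tangent_length; apply: is_derive_eq.
by rewrite /tangent_length_dr /GRing.scale /=; ring.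
Qed.

(* The mixed second derivative of [tangent_length] is the negative of the sum
   of the two tangent segments times [(1 + half_tan a b ^+ 2) / 2]. *)
Lemma tangent_length_dl_decr a b b' : a <= b -> b < b' -> b' < a + pi ->
  tangent_length_dl a b' < tangent_length_dl a b.
Proof.
move=> ab bb' b'a.
apply: (derive_lt (df := fun s => - ((1 + half_tan a s ^+ 2) / 2) *
  (tangent_length a s + k s - k a)) bb') => s sbb'.
  have /half_tan_derive_r dt : a - pi < s < a + pi.
    by have := pi_gt0 R; lra.
  have dh := h_derive s; rewrite /tangent_length_dl /tangent_length.
  by apply: is_derive_eq; rewrite /GRing.scale /=; field.
rewrite mulNr oppr_lt0; apply: mulr_gt0.
  by have := sqr_ge0 (half_tan a s); lra.
by apply: tangents_gt0; lra.
Qed.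

(** The increment from [b] to [b'] in the second argument has a negative derivative in the first
    one, by [tangent_length_dl_decr]. *)
Lemma tangent_length_monge_strict a a' b b' : a < a' -> a' <= b -> b < b' ->
    b' < a + pi ->
  tangent_length a b + tangent_length a' b' <
  tangent_length a b' + tangent_length a' b.
Proof.
move=> aa' a'b bb' b'a.
have : tangent_length a' b' - tangent_length a' b <
       tangent_length a b' - tangent_length a b.
  apply: (derive_lt (f := fun s => tangent_length s b' - tangent_length s b)
    (df := fun s => tangent_length_dl s b' - tangent_length_dl s b) aa')
    => s sa.
    have := pi_gt0 R => pi0.
    by apply: is_deriveB; apply: tangent_length_derive_l; lra.
  by rewrite subr_lt0; apply: tangent_length_dl_decr; lra.
by lra.
Qed.

Lemma tangent_length_monge a a' b b' : a <= a' -> a' <= b -> b <= b' ->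
    b' < a + pi ->
  tangent_length a b + tangent_length a' b' <=
  tangent_length a b' + tangent_length a' b.
Proof.
rewrite le_eqVlt => /predU1P[<-|aa'] a'b.
  by move=> _ _; rewrite addrC.
rewrite le_eqVlt => /predU1P[<- _|bb' b'a]; first by rewrite lexx.
exact/ltW/tangent_length_monge_strict.
Qed.

(** An interior minimum has zero derivative. The successor [c] ranges over [[b, b']] so that one
    range of competitors [s] serves both ends. *)
Lemma tangent_length_critical a t b b' c : a < t -> t < b -> t < a + pi ->
    b <= c <= b' -> b' < t + pi ->
    (forall s, a < s < b -> s < a + pi -> b' < s + pi ->
      tangent_length a t + tangent_length t c <=
      tangent_length a s + tangent_length s c) ->
  tangent_length_dr a t + tangent_length_dl t c = 0.
Proof.
move=> at_ tb ta bcb' b't tmin.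
pose f s := tangent_length a s + tangent_length s c.
have df s : Num.max a (b' - pi) < s < Num.min b (a + pi) ->
    is_derive s 1 f (tangent_length_dr a s + tangent_length_dl s c).
  rewrite gt_max lt_min => /andP[/andP[as_ cs] /andP[sb sa]].
  apply: is_deriveD; [apply: tangent_length_derive_r|
    apply: tangent_length_derive_l]; have := pi_gt0 R; lra.
have tI : Num.max a (b' - pi) < t < Num.min b (a + pi).
  by rewrite gt_max lt_min; lra.
have lohi : Num.max a (b' - pi) <= Num.min b (a + pi).
  by case/andP: tI => lo hi; exact: ltW (lt_trans lo hi).
have [] := @derive1_at_min R f _ _ t lohi; last by
  move=> _ <-; case: (df t tI).
- by move=> s; rewrite in_itv => /df[].
- by rewrite in_itv.
- move=> s; rewrite in_itv /= gt_max lt_min => /andP[/andP[? ?] /andP[? ?]].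
  by apply: tmin; lra.
Qed.

(** Both critical equations contain the same [tangent_length_dr a t], while [tangent_length_dl t]
    separates [b] from [b']. *)
Lemma tangent_length_no_corner a t b b' : a < t -> t < b -> b < b' ->
  t < a + pi -> b' < t + pi ->
  (forall s, a < s < b -> s < a + pi -> b' < s + pi ->
    tangent_length a t + tangent_length t b <=
    tangent_length a s + tangent_length s b) ->
  (forall s, a < s < b -> s < a + pi -> b' < s + pi ->
    tangent_length a t + tangent_length t b' <=
    tangent_length a s + tangent_length s b') -> False.
Proof.
move=> at_ tb bb' ta tb' mb mb'.
have bb'1 : b <= b <= b' by rewrite lexx ltW.
have bb'2 : b <= b' <= b' by rewrite lexx ltW.
have := tangent_length_critical at_ tb ta bb'1 tb' mb.
have := tangent_length_critical at_ tb ta bb'2 tb' mb'.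
by have := tangent_length_dl_decr (ltW tb) bb' tb'; lra.
Qed.

Lemma h_periodicn a m : h (a + 2 * pi * m%:R) = h a.
Proof. by rewrite mulr_natr (periodicn h_periodic). Qed.

Lemma h_periodicz a (m : int) : h (a + 2 * pi * m%:~R) = h a.
Proof.
case: m => n; first exact: h_periodicn.
by rewrite -(h_periodicn _ n.+1) NegzE mulrNz mulrN addrNK.
Qed.

Lemma tangent_length_shiftz a b (m : int) :
  tangent_length (a + 2 * pi * m%:~R) (b + 2 * pi * m%:~R) =
  tangent_length a b.
Proof.
by rewrite /tangent_length /half_tan !h_periodicz opprD addrACA subrr addr0.
Qed.

Lemma tangent_length_shiftn a b (p : nat) :
  tangent_length (a + 2 * pi * p%:R) (b + 2 * pi * p%:R) =
  tangent_length a b.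
Proof. exact: (tangent_length_shiftz a b p). Qed.

Lemma tangent_length_diag a : tangent_length a a = 0.
Proof. by rewrite /tangent_length /half_tan subrr mul0r tan0 mulr0. Qed.

Lemma half_tan_ge0 a b : 0 <= b - a < pi -> 0 <= half_tan a b.
Proof.
move=> ab; rewrite /half_tan -tan0 leNgt ltr_tan ?in_itv /= -?leNgt; lra.
Qed.

Lemma tangent_length_ge0 a b : 0 <= b - a < pi -> 0 <= tangent_length a b.
Proof.
move=> ab; apply: mulr_ge0; last exact: half_tan_ge0.
by rewrite addr_ge0 // ltW.
Qed.

(** * Existence of shortest circumscribed polygons *)

Lemma h_lower_bound : exists2 r, 0 < r & forall a, r <= h a.
Proof.
have [||c _ hmin] := @EVT_min R h 0 (2 * pi).
- by have := pi_gt0 R; lra.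
- by apply: derivable_within_continuous => x _; case: (h_derive x).
exists (h c) => // a; have pi20 : 0 < 2 * (pi : R) by have := pi_gt0 R; lra.
rewrite -(h_periodicz a (- Num.floor (a / (2 * pi)))); apply: hmin.
rewrite in_itv /= mulrNz mulrN.
have := floor_itv (a / (2 * pi)).
rewrite intrD ler_pdivlMr // ltr_pdivrMr // => fl.
by apply/andP; split; lra.
Qed.

Lemma tangent_length_continuous (x : {ptws nat -> R}) i :
  0 <= x i.+1 - x i < pi ->
  {for x, continuous
    (fun y : {ptws nat -> R} => tangent_length (y i) (y i.+1))}.
Proof.
move=> xi.
have pc j : {for x, continuous (fun y : {ptws nat -> R} => y j)}.
  exact: (@proj_continuous nat (fun=> R) j x).
have hc a : {for a, continuous h}.
  by apply: differentiable_continuous; apply/derivable1_diffP;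
    case: (h_derive a).
apply: continuousM.
  by apply: continuousD; (apply: continuous_comp; [exact: pc|exact: hc]).
apply: (@continuous_comp _ _ _
  (fun y : {ptws nat -> R} => (y i.+1 - y i) / 2) tan).
  by apply: continuousM; [apply: continuousB; exact: pc|exact: cst_continuous].
by apply: continuous_tan; apply: cos_half_neq0; have := pi_gt0 R; lra.
Qed.

Lemma chain_length_continuous n (x : {ptws nat -> R}) :
  (forall i, 0 <= x i.+1 - x i < pi) ->
  {for x, continuous (chain_length tangent_length n : {ptws nat -> R} -> R)}.
Proof.
move=> hx; elim: n => [|n IH].
  have -> : chain_length tangent_length 0 = cst 0.
    by apply/funext => y; rewrite /chain_length big_geq.
  exact: cst_continuous.
have -> : chain_length tangent_length n.+1 =
    (fun y => chain_length tangent_length n y +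
              tangent_length (y n) (y n.+1)).
  by apply/funext => y; rewrite /chain_length big_nat_recr.
by apply: continuousD => //; exact: tangent_length_continuous.
Qed.

(** The strict bound [pi] on the steps is not a closed condition; [M] replaces it. *)
Lemma closed_bounded_chains n (C M : R) : closed
  [set x : {ptws nat -> R} | (forall i, 0 <= x i.+1 - x i <= M) /\
                             (forall i, x (i + n)%N - x i = C)].
Proof.
have pc j : continuous (fun y : {ptws nat -> R} => y j : R).
  exact: (@proj_continuous nat (fun=> R) j).
have sc i j : continuous (fun y : {ptws nat -> R} => y i - y j : R).
  by move=> x; apply: continuousB; exact: pc.
have -> : [set x : {ptws nat -> R} | (forall i, 0 <= x i.+1 - x i <= M) /\
                             (forall i, x (i + n)%N - x i = C)] =
    (\bigcap_(i in [set: nat]) (fun y : {ptws nat -> R} => y i.+1 - y i : R)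
       @^-1` `[0, M]) `&`
    (\bigcap_(i in [set: nat])
       (fun y : {ptws nat -> R} => y (i + n)%N - y i : R) @^-1` [set C]).
  apply/seteqP; split=> x /= [x1 x2]; split=> i.
  - by move=> _; rewrite /= in_itv /=; exact: x1.
  - by move=> _; exact: x2.
  - by have := x1 i Logic.I; rewrite /= in_itv.
  - exact: (x2 i Logic.I).
apply: closedI; apply: closed_bigI => i _.
  by move/continuous_closedP : (sc i.+1 i); apply; exact: itv_closed.
by move/continuous_closedP : (sc (i + n)%N i); apply; exact: closed_eq.
Qed.

(** The tangent blows up at [pi / 2] while [h] stays above some [r > 0]; [M] solves
    [2 * r * tan (M / 2) = S0]. *)
Lemma tangent_length_step_bound (S0 : R) : 0 <= S0 ->
  exists2 M, M < pi & forall a b, 0 <= b - a < pi ->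
    tangent_length a b <= S0 -> b - a <= M.
Proof.
move=> S00; have [r r0 hr] := h_lower_bound.
exists (2 * atan (S0 / (2 * r))).
  by have := atan_ltpi2 (S0 / (2 * r)); lra.
move=> a b ab; apply: contraTT; rewrite -!ltNge => ltM.
have ltt : S0 / (2 * r) < half_tan a b.
  rewrite -[X in X < _]atanK ltr_tan ?in_itv /=; first lra.
    by rewrite atan_gtNpi2 atan_ltpi2.
  by have := pi_gt0 R; lra.
have t0 := half_tan_ge0 ab.
apply: (@lt_le_trans _ _ ((2 * r) * half_tan a b)).
  by rewrite -ltr_pdivrMl ?mulr_gt0 // mulrC.
by rewrite ler_wpM2r //; have := hr a; have := hr b; lra.
Qed.

(** The chains no longer than a reference chain, normalized by a rotation, lie in a compact set of
    chains on which the length is continuous. *)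
Lemma minimal_chain_exists n p : (2 * p < n)%N ->
  exists x, minimal_chain pi (2 * pi * p%:R) tangent_length n x.
Proof.
move=> pn; set C := 2 * pi * p%:R; have pi0 := pi_gt0 R.
have n0 : (0 : R) < n%:R by rewrite ltr0n; lia.
have n0' : (0 < n)%N by lia.
have C0 : 0 <= C by rewrite !mulr_ge0 // ltW.
(* The equiangular reference chain; its step is below [pi] since [2 * p < n]. *)
pose d := C / n%:R; pose x0 (i : nat) : R := i%:R * d.
have d0 : 0 <= d by rewrite divr_ge0 // ltW.
have dpi : d < pi.
  rewrite ltr_pdivrMr // /C mulrAC mulrC ltr_pM2l //.
  by rewrite -natrM ltr_nat.
have x0step i : x0 i.+1 - x0 i = d by rewrite /x0 -natr1; ring.
have hx0 : chain pi C n x0.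
  split=> i; first by rewrite x0step d0.
  by rewrite /x0 natrD mulrDl [n%:R * d]mulrC divfK // gt_eqF.
have len_ge x : chain pi C n x ->
    forall i, tangent_length (x i) (x i.+1) <= chain_length tangent_length n x.
  move=> hx i; have Gp a b := tangent_length_shiftn a b p.
  rewrite -(chain_length_shift Gp i hx).
  rewrite /chain_length big_ltn // addn0 addn1 lerDl.
  apply: sumr_ge0 => j _; apply: tangent_length_ge0.
  by rewrite addnS; exact: hx.1.
have len0 : 0 <= chain_length tangent_length n x0.
  apply: le_trans (len_ge _ hx0 0%N); apply: tangent_length_ge0.
  exact: hx0.1.
have [M Mpi hM] := tangent_length_step_bound len0.
pose D := [set x : {ptws nat -> R} | (forall i, 0 <= x i.+1 - x i <= M) /\
                             (forall i, x (i + n)%N - x i = C)].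
(* A chain starting in [[0, 2 * pi]] stays in these intervals, whose product is compact by
   Tychonoff. *)
pose I (i : nat) : set R := `[0, 2 * pi + i%:R * pi]%classic.
pose B := [set x : {ptws nat -> R} | forall i, I i (x i)].
have cB : compact B.
  by apply: (@tychonoff nat (fun=> R) I) => i; exact: segment_compact.
have cK : compact (B `&` D).
  by apply: compact_closedI => //; exact: closed_bounded_chains.
have KP x : (B `&` D) x -> chain pi C n x.
  move=> [_ [x1 x2]]; split=> i.
    by have /andP[-> /le_lt_trans->] := x1 i.
  by rewrite -(x2 i) addrC addrNK.
have PK x : chain pi C n x -> 0 <= x 0%N <= 2 * pi ->
    chain_length tangent_length n x <= chain_length tangent_length n x0 ->
    (B `&` D) x.
  move=> hx x00 lex.
  have x1 i : 0 <= x i.+1 - x i <= M.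
    have xi := hx.1 i; have /andP[-> _] := xi.
    by apply: hM => //; apply: le_trans lex; exact: len_ge.
  split; last by split=> // i; rewrite hx.2 addrC addKr.
  move=> i; rewrite /I /= in_itv /=; elim: i => [|i IH].
    by rewrite mul0r addr0.
  by have := x1 i; rewrite -natr1; lra.
have lenC : {within B `&` D, continuous
    (chain_length tangent_length n : {ptws nat -> R} -> R)}.
  apply: continuous_in_subspaceT => x /set_mem /KP [x1 _].
  exact: chain_length_continuous.
have K0 : (B `&` D) x0 by apply: PK => //; rewrite /x0 mul0r; lra.
have [|x /set_mem xK xmin] := compact_EVT_min _ cK lenC; first by exists x0.
exists x; split; first exact: KP.
move=> y hy.
have [ley|lty] := leP (chain_length tangent_length n y)
  (chain_length tangent_length n x0); last first.
  by apply: le_trans (ltW lty); apply: xmin; exact: mem_set.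
(* Full turns bring the initial angle into [[0, 2 * pi]] without changing the length. *)
pose m := (- Num.floor (y 0%N / (2 * pi)))%R.
pose z i := y i + 2 * pi * m%:~R.
have lenz : chain_length tangent_length n z = chain_length tangent_length n y.
  by apply: eq_big_nat => i _; rewrite tangent_length_shiftz.
have hz : chain pi C n z.
  case: hy => y1 y2; split=> i; last by rewrite /z y2 addrAC.
  by rewrite /z opprD addrACA subrr addr0.
rewrite -lenz; apply: xmin; apply: mem_set; apply: PK; rewrite ?lenz //.
rewrite /z /m mulrNz mulrN.
have := floor_itv (y 0%N / (2 * pi)).
rewrite intrD ler_pdivlMr ?ltr_pdivrMr; try lra.
Qed.

End SupportFunction.

(** * Coordinatewise derivatives and elementary estimates *)

Section RealAnalysis.
Variable R : realType.
Implicit Types (a b s t : R).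

Lemma is_derive_fst (c : R -> R * R) t : derivable c t 1 ->
  is_derive t 1 (fun s => (c s).1) (derive1 c t).1.
Proof.
move=> dc; rewrite derive1E.
have cv : h^-1 *: (((fun s => (c s).1) \o shift t) (h *: 1) - (c t).1)
    @[h --> 0^'] --> ('D_1 c t).1.
  have fstC : fst x @[x --> 'D_1 c t] --> ('D_1 c t).1.
    by case: ('D_1 c t) => u v; exact: cvg_fst.
  exact: (cvg_comp _ fst dc fstC).
split; first exact: cvgP cv.
exact: cvg_lim cv.
Qed.

Lemma is_derive_snd (c : R -> R * R) t : derivable c t 1 ->
  is_derive t 1 (fun s => (c s).2) (derive1 c t).2.
Proof.
move=> dc; rewrite derive1E.
have cv : h^-1 *: (((fun s => (c s).2) \o shift t) (h *: 1) - (c t).2)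
    @[h --> 0^'] --> ('D_1 c t).2.
  have sndC : snd x @[x --> 'D_1 c t] --> ('D_1 c t).2.
    by case: ('D_1 c t) => u v; exact: cvg_snd.
  exact: (cvg_comp _ snd dc sndC).
split; first exact: cvgP cv.
exact: cvg_lim cv.
Qed.

Lemma sin_lipschitz a b : `|sin b - sin a| <= `|b - a|.
Proof.
wlog ab : a b / a <= b.
  by move=> H; have [/H//|/ltW/H] := leP a b;
    rewrite distrC [X in _ <= X]distrC.
have [|s _ ->] := @MVT_segment R sin cos a b ab.
  by apply: continuous_subspaceT; exact: continuous_sin.
by rewrite normrM ler_piMl // cos_max.
Qed.

Lemma cos_lipschitz a b : `|cos b - cos a| <= `|b - a|.
Proof.
wlog ab : a b / a <= b.
  by move=> H; have [/H//|/ltW/H] := leP a b;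
    rewrite distrC [X in _ <= X]distrC.
have [|s _ ->] := @MVT_segment R cos (fun x => - sin x) a b ab.
  by apply: continuous_subspaceT; exact: continuous_cos.
by rewrite normrM normrN ler_piMl // sin_max.
Qed.

Lemma is_derive_little_o (e : R -> R) a : e a = 0 ->
    (forall eps, 0 < eps -> exists2 d, 0 < d &
      forall b, `|b - a| < d -> `|e b| <= eps * `|b - a|) ->
  is_derive a 1 e 0.
Proof.
move=> ea he.
have cv : h^-1 *: ((e \o shift a) (h *: 1) - e a) @[h --> 0^'] --> (0 : R).
  apply/cvgrPdist_le => eps /he [d d0 hd]; near=> x.
  have x0 : x != 0 by near: x; exact: nbhs_dnbhs_neq.
  have xd : `|x| < d.
    near: x; apply: nbhs_dnbhs; exists d => //= y.
    by rewrite /= sub0r normrN.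
  rewrite sub0r normrN ea subr0 /= [_ *: 1]mulr1 normrM normfV.
  rewrite ler_pdivrMl ?normr_gt0 // mulrC.
  by have := hd (x + a); rewrite addrK; apply.
split; first exact: cvgP cv.
exact: cvg_lim cv.
Unshelve. all: by end_near.
Qed.

End RealAnalysis.

(** * Tangent lines of a strictly convex curve *)

Section Curve.
Variables (R : realType) (T : R) (c : R -> R * R).
Hypothesis hc : smooth_strictly_convex_closed T c.
Implicit Types (a b s t : R) (P : R * R).

(* The outer normal to the tangent line of direction [a] is
   [(sin a, - cos a)]. *)
Definition height a P : R := P.1 * sin a - P.2 * cos a.

Let T_gt0 : 0 < T. Proof. by case: hc => -[]. Qed.

Let c_periodic t : c (t + T) = c t. Proof. by case: hc => -[]. Qed.

Let c_derivable t : derivable c t 1.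
Proof. by case: hc => _ /(_ 0%N). Qed.

Let c_fst t := is_derive_fst (@c_derivable t).
Let c_snd t := is_derive_snd (@c_derivable t).

Lemma curve_param t : exists2 s, 0 <= s < T & c s = c t.
Proof.
have cn s (n : nat) : c (s + T * n%:R) = c s.
  rewrite mulr_natr; elim: n => [|n IH]; first by rewrite addr0.
  by rewrite mulrSr addrA c_periodic.
have cz s (m : int) : c (s + T * m%:~R) = c s.
  case: m => n; first exact: cn.
  by rewrite -[LHS](cn _ n.+1) NegzE mulrNz mulrN addrNK.
exists (t + T * (- Num.floor (t / T))%:~R); last exact: cz.
rewrite mulrNz mulrN; have := floor_itv (t / T).
by rewrite intrD ler_pdivlMr ?ltr_pdivrMr //; lra.
Qed.

Lemma c0_neq : c 0 != c (T / 2).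
Proof.
apply/eqP => eq0; have [_ _ _ injc _] := hc.
have T0 := T_gt0; suff : (0 : R) = T / 2 by lra.
by apply: injc eq0; rewrite in_itv /=; lra.
Qed.

Lemma curve_other P : exists2 s, 0 <= s <= T & c s != P.
Proof.
have inj := c0_neq.
have [eqP|neP] := eqVneq (c 0) P; last by exists 0 => //; have := T_gt0; lra.
by exists (T / 2); [have := T_gt0; lra|rewrite -eqP eq_sym].
Qed.

Lemma height_derive a t : is_derive t 1 (fun s => height a (c s))
  (height a (derive1 c t)).
Proof.
have d1 := c_fst t; have d2 := c_snd t.
by rewrite /height; apply: is_derive_eq; rewrite /GRing.scale /=; ring.
Qed.

Lemma height_continuous a : continuous (fun s => height a (c s)).
Proof.
move=> t; apply: differentiable_continuous; apply/derivable1_diffP.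
by case: (height_derive a t).
Qed.

Lemma height_critical a t : (forall s, height a (c s) <= height a (c t)) ->
  height a (derive1 c t) = 0.
Proof.
move=> tmax.
have := @derive1_at_max R (fun s => height a (c s)) (t - 1) (t + 1) t.
case.
- lra.
- by move=> s _; case: (height_derive a s).
- by rewrite in_itv /=; lra.
- by move=> s _; exact: tmax.
by move=> _ <-; case: (height_derive a t).
Qed.

(** The determinant in the convexity condition is [r] times the drop in height from [c t] to
    [c s]. *)
Lemma tangent_height_lt a t r s : 0 < r -> derive1 c t = r *: direction a ->
  c s != c t -> height a (c s) < height a (c t).
Proof.
move=> r0 ct st; have [_ _ _ _ conv] := hc.
have := conv s t st; rewrite ct /det2 /= /height.
rewrite /GRing.scale /= -!mulrA -mulrBr pmulr_rgt0 //; lra.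
Qed.

(** At a highest point the velocity is parallel to [direction a]; a negative factor would, by
    convexity, place the other points higher. *)
Lemma tangent_param_exists a :
  exists t r, 0 < r /\ derive1 c t = r *: direction a.
Proof.
have [|t0 _ tmax0] := @EVT_max R (fun s => height a (c s)) 0 T (ltW T_gt0).
  by apply: continuous_subspaceT; exact: height_continuous.
have tmax s : height a (c s) <= height a (c t0).
  have [s' s'T <-] := curve_param s; apply: tmax0.
  by rewrite in_itv /=; lra.
have crit := height_critical tmax.
pose r := (derive1 c t0).1 * cos a + (derive1 c t0).2 * sin a.
have sc := cos2Dsin2 a.
have ct : derive1 c t0 = r *: direction a.
  move: crit; rewrite /height /r; case: (derive1 c t0) => u v /= crit.
  congr pair; rewrite /GRing.scale /=.
    have -> : (u * cos a + v * sin a) * cos a =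
      u * (cos a ^+ 2 + sin a ^+ 2) - sin a * (u * sin a - v * cos a) by ring.
    by rewrite sc crit; ring.
  have -> : (u * cos a + v * sin a) * sin a =
      v * (cos a ^+ 2 + sin a ^+ 2) + cos a * (u * sin a - v * cos a) by ring.
  by rewrite sc crit; ring.
exists t0, r; split=> //; rewrite ltNge; apply/negP => r0.
have [_ _ c'0 _ conv] := hc.
have rlt0 : r < 0.
  rewrite lt_neqAle r0 andbT; apply: contraNneq (c'0 t0) => r00.
  by rewrite ct r00 scale0r.
have [s _ st] := curve_other (c t0).
have := conv s t0 st; have := tmax s.
rewrite ct /det2 /= /height /GRing.scale /= -!mulrA -mulrBr nmulr_rgt0 //; lra.
Qed.

Lemma tangencyP a : exists t r,
  [/\ tangency c a = c t, 0 < r & derive1 c t = r *: direction a].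
Proof.
have : [set P | exists t, P = c t /\
          exists2 r, 0 < r & derive1 c t = r *: direction a] (tangency c a).
  apply: getPex; have [t [r [r0 ct]]] := tangent_param_exists a.
  by exists (c t), t; split=> //; exists r.
by move=> [t [-> [r r0 ct]]]; exists t, r.
Qed.

Lemma height_tangency_lt a s : c s != tangency c a ->
  height a (c s) < height a (tangency c a).
Proof.
by have [t [r [-> r0 ct]]] := tangencyP a; exact: tangent_height_lt r0 ct.
Qed.

Lemma height_tangency_le a s : height a (c s) <= height a (tangency c a).
Proof.
by have [->//|/height_tangency_lt/ltW] := eqVneq (c s) (tangency c a).
Qed.

Lemma tangency_periodic a : tangency c (a + 2 * pi) = tangency c a.
Proof.
by rewrite /tangency /direction mulr_natl cosD2pi sinD2pi.
Qed.

(** At a common point the velocity, parallel to [direction a], would have height zero for [b], but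
    it has a nonzero multiple of [sin (b - a)]. *)
Lemma tangency_neq a b : 0 < b - a < pi -> tangency c a != tangency c b.
Proof.
move=> ab; apply/eqP => eqab.
have [t [r [ct r0 dt]]] := tangencyP a.
have : height b (derive1 c t) = 0.
  by apply: height_critical => s; rewrite -ct eqab; exact: height_tangency_le.
rewrite dt /height /= /GRing.scale /= -!mulrA -mulrBr.
have -> : cos a * sin b - sin a * cos b = sin (b - a) by rewrite sinB; ring.
by apply/eqP; rewrite mulf_neq0 ?gt_eqF // sin_gt0_pi.
Qed.

(** * Continuity of the tangency point and the support function *)

Let dist1 P Q : R := `|P.1 - Q.1| + `|P.2 - Q.2|.

Lemma height_rotation a b P Q :
  height b P - height b Q - (height a P - height a Q) <=
  dist1 P Q * `|b - a|.
Proof.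
have -> : height b P - height b Q - (height a P - height a Q) =
    (P.1 - Q.1) * (sin b - sin a) + (P.2 - Q.2) * (cos a - cos b).
  by rewrite /height; ring.
rewrite /dist1 [X in _ <= X]mulrDl; apply: lerD; apply: le_trans (ler_norm _) _;
  rewrite normrM ler_wpM2l //; first exact: sin_lipschitz.
by rewrite distrC; exact: cos_lipschitz.
Qed.

(** By compactness, curve points at distance at least [eps] from [tangency c a] are lower by a fixed
    gap; [height_rotation] bounds the drop of [tangency c b] by a multiple of the angle. *)
Lemma tangency_continuous a eps : 0 < eps -> exists2 d, 0 < d &
  forall b, `|b - a| < d -> dist1 (tangency c b) (tangency c a) <= eps.
Proof.
move=> eps0; pose D t := dist1 (c t) (tangency c a).
have cC1 : continuous (fun t => (c t).1).
  move=> t; apply: differentiable_continuous; apply/derivable1_diffP.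
  by case: (c_fst t).
have cC2 : continuous (fun t => (c t).2).
  move=> t; apply: differentiable_continuous; apply/derivable1_diffP.
  by case: (c_snd t).
have DC : continuous D.
  move=> t.
  by apply: cvgD; apply: cvg_norm; apply: cvgB;
    [exact: cC1|exact: cvg_cst|exact: cC2|exact: cvg_cst].
have [|tB _ hB] := @EVT_max R D 0 T (ltW T_gt0).
  exact: continuous_subspaceT.
have {}hB b : dist1 (tangency c b) (tangency c a) <= D tB.
  have [t [_ [-> _ _]]] := tangencyP b; have [s s0 <-] := curve_param t.
  by apply: hB; rewrite in_itv /=; lra.
pose K := `[0, T]%classic `&` [set t | eps <= D t].
have cK : compact K.
  apply: compact_closedI; first exact: segment_compact.
  by move/continuous_closedP : DC => /(_ _ (@closed_ge R eps)).
have [K0|/set0P K0] := eqVneq K set0.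
  exists 1 => // b _.
  have [t [_ [-> _ _]]] := tangencyP b; have [s s0 <-] := curve_param t.
  rewrite leNgt; apply/negP => /ltW le_eps.
  suff : K s by rewrite K0.
  by split=> //=; rewrite in_itv /=; lra.
have gC : {within K, continuous (fun t => - height a (c t))}.
  by apply: continuous_subspaceT => t; apply: cvgN; exact: height_continuous.
have [tm /set_mem[_ /= eD] hm] := compact_EVT_min K0 cK gC.
have m0 : height a (c tm) < height a (tangency c a).
  apply: height_tangency_lt; apply: contraTneq eps0 => eqt.
  by rewrite -leNgt (le_trans eD) // /D eqt /dist1 !subrr normr0 addr0.
have B0 : 0 <= D tB by rewrite addr_ge0.
exists ((height a (tangency c a) - height a (c tm)) / (D tB + 1)).
  by rewrite divr_gt0 // ?subr_gt0 //; lra.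
move=> b; rewrite ltr_pdivlMr; last lra.
move=> ltb; rewrite leNgt; apply/negP => lt_eps.
have le1 := height_rotation a b (tangency c b) (tangency c a).
have [t [_ [eqt _ _]]] := tangencyP b; have [s s0 cs] := curve_param t.
have [u [_ [equ _ _]]] := tangencyP a.
have Ks : s \in K.
  apply/mem_set; split => /=; first by rewrite in_itv /=; lra.
  by rewrite /D cs -eqt ltW.
have le2 := hm s Ks; have le3 := height_tangency_le b u.
rewrite cs -eqt in le2; rewrite -equ in le3.
have := ler_wpM2r (normr_ge0 (b - a)) (hB b).
by have := normr_ge0 (b - a); lra.
Qed.

(* The midpoint of a chord lies inside the curve, so that the support function
   taken from it is positive. *)
Definition center : R * R := 2^-1 *: (c 0 + c (T / 2)).

Definition support a : R := height a (tangency c a) - height a center.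

(** The coordinate of the tangency point along the tangent direction, measured from [center]. *)
Definition support' a : R :=
  ((tangency c a).1 - center.1) * cos a + ((tangency c a).2 - center.2) * sin a.

(** Envelope argument: freezing the tangency point at [a] costs between [0] and its displacement
    times the angle, a term of smaller order. This covers points of zero curvature too. *)
Lemma support_derive a : is_derive a 1 support (support' a).
Proof.
pose e b := height b (tangency c b) - height b (tangency c a).
have de : is_derive a 1 e 0.
  apply: is_derive_little_o; first by rewrite /e subrr.
  move=> eps /(tangency_continuous a)[d d0 hd]; exists d => // b bd.
  have [t [_ [eqt _ _]]] := tangencyP b; have [u [_ [equ _ _]]] := tangencyP a.
  have e0 : 0 <= e b by rewrite /e subr_ge0 equ; exact: height_tangency_le.
  rewrite ger0_norm //.
  apply: le_trans (ler_wpM2r (normr_ge0 (b - a)) (hd _ bd)).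
  have := height_rotation a b (tangency c b) (tangency c a).
  by have := height_tangency_le a t; rewrite -eqt /e; lra.
have -> : support = (fun b => e b +
    (height b (tangency c a) - height b center)).
  by apply/funext => b; rewrite /support /e; ring.
rewrite /height; apply: is_derive_eq.
by rewrite /support' /GRing.scale /=; ring.
Qed.

Lemma support_periodic a : support (a + 2 * pi) = support a.
Proof.
by rewrite /support tangency_periodic /height mulr_natl sinD2pi cosD2pi.
Qed.

Lemma support'_periodic a : support' (a + 2 * pi) = support' a.
Proof. by rewrite /support' tangency_periodic mulr_natl sinD2pi cosD2pi. Qed.

Lemma support_gt0 a : 0 < support a.
Proof.
have -> : support a = (height a (tangency c a) - height a (c 0)) / 2 +
    (height a (tangency c a) - height a (c (T / 2))) / 2.
  by rewrite /support /center /height /= /GRing.scale /=; field.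
have le0 := height_tangency_le a 0.
have le1 := height_tangency_le a (T / 2).
have [eq0|/height_tangency_lt] := eqVneq (c 0) (tangency c a); last lra.
have := c0_neq; rewrite eq0 eq_sym => /height_tangency_lt; lra.
Qed.

(** * Tangent segments and the perimeter *)

Lemma half_tan_sin a b : 0 < b - a < pi ->
  half_tan a b * sin (b - a) = 1 - cos (b - a).
Proof.
move=> ab; rewrite /half_tan; set x := (b - a) / 2.
have -> : b - a = x + x by rewrite /x; lra.
have cx : cos x != 0 by apply: cos_half_neq0; lra.
by rewrite sinD cosD /tan -[1](cos2Dsin2 x); field.
Qed.

(** Seen from [center], [tangency c a] has normal coordinate [support a] and tangential coordinate
    [support' a]; these are projected to the normal at [b]. *)
Lemma support_sub a b : height b (tangency c a) - height b center =
  support a * cos (b - a) + support' a * sin (b - a).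
Proof.
have [sb cb] : sin b = sin a * cos (b - a) + cos a * sin (b - a) /\
    cos b = cos a * cos (b - a) - sin a * sin (b - a).
  by rewrite -sinD -cosD addrC subrK.
have sc : sin a ^+ 2 = 1 - cos a ^+ 2 by rewrite -(cos2Dsin2 a); ring.
by rewrite /support /support' /height sb cb; ring: sc.
Qed.

(** Each difference on the right is the distance of one tangency point from the other tangent line,
    so [sin (b - a)] times a tangent segment. *)
Lemma tangent_segments a b : 0 < b - a < pi ->
  (tangent_length support a b + support' b - support' a) * sin (b - a) =
  (height b (tangency c b) - height b (tangency c a)) +
  (height a (tangency c a) - height a (tangency c b)).
Proof.
move=> ab; rewrite /tangent_length.
have := half_tan_sin ab; set t := half_tan a b => tE.
have := support_sub a b; have := support_sub b a.
rewrite -(opprB b a) sinN cosN.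
have -> : (((support a + support b) * t + support' b) - support' a) *
    sin (b - a) = (support a + support b) * (t * sin (b - a)) +
    (support' b - support' a) * sin (b - a) by ring.
by rewrite tE /support; lra.
Qed.

Lemma height_tangency_neq_lt a b : 0 < b - a < pi ->
  0 < height b (tangency c b) - height b (tangency c a) /\
  0 < height a (tangency c a) - height a (tangency c b).
Proof.
move=> /tangency_neq neq.
have [t [_ [eqt _ _]]] := tangencyP a; have [u [_ [equ _ _]]] := tangencyP b.
split; rewrite subr_gt0; first by rewrite eqt height_tangency_lt // -eqt.
by rewrite equ height_tangency_lt // -equ eq_sym.
Qed.

Lemma tangent_segments_gt0 a b : a < b < a + pi ->
  0 < tangent_length support a b + support' b - support' a.
Proof.
move=> ab; have ab' : 0 < b - a < pi by lra.
have [hS hT] := height_tangency_neq_lt ab'.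
by rewrite -(pmulr_lgt0 _ (sin_gt0_pi ab')) tangent_segments //; lra.
Qed.

Lemma vertexP a b : 0 <= b - a < pi -> exists s t,
  [/\ 0 <= s, 0 <= t,
      s + t = tangent_length support a b + support' b - support' a,
      vertex c a b = tangency c a + s *: direction a &
      vertex c a b = tangency c b - t *: direction b].
Proof.
move=> ab; rewrite /vertex; have [->|neab] := eqVneq a b.
  exists 0, 0; rewrite !scale0r addr0 subr0 tangent_length_diag.
  by split=> //; ring.
have ab' : 0 < b - a < pi.
  by case/andP: ab => ab0 ->; rewrite andbT lt_def subr_eq0 eq_sym neab.
have [hS hT] := height_tangency_neq_lt ab'.
have sgt0 := sin_gt0_pi ab'; have sn0 : sin (b - a) != 0 by rewrite gt_eqF.
have sab : sin b * cos a - cos b * sin a = sin (b - a) by rewrite sinB.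
pose s := (height b (tangency c b) - height b (tangency c a)) / sin (b - a).
pose t := (height a (tangency c a) - height a (tangency c b)) / sin (b - a).
have st : tangency c a + s *: direction a = tangency c b - t *: direction b.
  rewrite /s /t /height.
  case: (tangency c a) => x y; case: (tangency c b) => z w.
  by congr pair; rewrite /= /GRing.scale /= -sab in sn0 *; field.
exists s, t.
(* The intersection point is unique because [sin (b - a)] does not vanish. *)
have inter : get (tangent_line c a `&` tangent_line c b) =
    tangency c a + s *: direction a.
  have : (tangent_line c a `&` tangent_line c b)
      (get (tangent_line c a `&` tangent_line c b)).
    apply: getPex; exists (tangency c a + s *: direction a).
    by split; [exists s|exists (- t) => //; rewrite scaleNr st].
  move=> [[r _ <-] [r' _ eqr]]; congr (_ + _ *: _).
  apply: (mulIf sn0); rewrite /s divfK // -sab.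
  move: eqr; rewrite /height; case: (tangency c a) => x y.
  case: (tangency c b) => z w [/=]; rewrite /GRing.scale /= => e1 e2.
  have -> : z = x + r * cos a - r' * cos b by rewrite -e1; ring.
  have -> : w = y + r * sin a - r' * sin b by rewrite -e2; ring.
  by ring.
split=> //; first by rewrite divr_ge0 // ltW.
- by rewrite divr_ge0 // ltW.
- by apply: (mulIf sn0); rewrite tangent_segments // /s /t; field.
- by rewrite inter st.
Qed.

Lemma edist_direction P a s t : 0 <= s -> 0 <= t ->
  Defs.edist (P - t *: direction a) (P + s *: direction a) = t + s.
Proof.
move=> s0 t0; rewrite /Defs.edist /= /GRing.scale /=.
rewrite (_ : _ + _ = (t + s) ^+ 2).
  by rewrite sqrtr_sqr ger0_norm ?addr_ge0.
transitivity ((t + s) ^+ 2 * (cos a ^+ 2 + sin a ^+ 2)); first by ring.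
by rewrite cos2Dsin2 mulr1.
Qed.

Lemma tangency_periodicn a p : tangency c (a + 2 * pi * p%:R) = tangency c a.
Proof.
elim: p => [|p IH]; first by rewrite mulr0 addr0.
by rewrite -[p.+1%:R]natr1 mulrDr mulr1 addrA tangency_periodic.
Qed.

Lemma direction_periodicn a p : direction (a + 2 * pi * p%:R) = direction a.
Proof.
have -> : 2 * pi * p%:R = (pi *+ 2) *+ p :> R by rewrite mulr_natr mulr_natl.
by rewrite /direction (periodicn (@cosD2pi R)) (periodicn (@sinD2pi R)).
Qed.

Lemma support'_periodicn a p : support' (a + 2 * pi * p%:R) = support' a.
Proof. by rewrite mulr_natr (periodicn support'_periodic). Qed.

(** The point of tangency splits each side into two tangent segments; these are regrouped by vertex,
    and the terms in [support'] telescope. *)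
Lemma perimeterE (p q : nat) (th : nat -> R) : (0 < q)%N ->
  circumscribed p q th ->
  perimeter c q th = chain_length (tangent_length support) q th.
Proof.
case: q => // n _ [th1 th2].
have /choice[st hst] : forall i, exists st : R * R, (i < n.+1)%N ->
  [/\ 0 <= st.1, 0 <= st.2,
      st.1 + st.2 = tangent_length support (th i) (th i.+1) +
        (support' (th i.+1) - support' (th i)),
      vertex c (th i) (th i.+1) = tangency c (th i) + st.1 *: direction (th i) &
      vertex c (th i) (th i.+1) =
        tangency c (th i.+1) - st.2 *: direction (th i.+1)].
  move=> i; have [lt_in|_] := ltnP i n.+1; last by exists (0, 0).
  have [s [t [s0 t0 stE v1 v2]]] := vertexP (th1 _ lt_in).
  by exists (s, t) => _; split=> /=; rewrite ?stE // -!addrA.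
have edge (i : 'I_n.+1) : Defs.edist (vertex c (th i) (th i.+1))
    (vertex c (th (i.+1 %% n.+1)%N) (th (i.+1 %% n.+1).+1)) =
    (st i).2 + (st (i.+1 %% n.+1)%N).1.
  have [_ t0 _ _ ->] := hst _ (ltn_ord i).
  have lt_j : (i.+1 %% n.+1 < n.+1)%N by rewrite ltn_mod.
  have [s0 _ _ -> _] := hst _ lt_j.
  (* For the last side the index wraps to [0], where the angle differs by [p] full turns. *)
  have [-> ->] : tangency c (th (i.+1 %% n.+1)%N) = tangency c (th i.+1) /\
      direction (th (i.+1 %% n.+1)%N) = direction (th i.+1).
    have := ltn_ord i; rewrite leq_eqVlt => /predU1P[->|lti].
      by rewrite modnn th2 tangency_periodicn direction_periodicn.
    by rewrite modn_small.
  exact: edist_direction.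
rewrite /perimeter (eq_bigr _ (fun i _ => edge i)) big_split /=.
have -> : \sum_(i < n.+1) (st (i.+1 %% n.+1)%N).1 = \sum_(i < n.+1) (st i).1.
  rewrite big_ord_recr big_ord_recl /= modnn addrC; congr (_ + _).
  by apply: eq_bigr => i _; rewrite modn_small // ltnS.
rewrite addrC -big_split /=.
transitivity (\sum_(i < n.+1) (tangent_length support (th i) (th i.+1) +
        (support' (th i.+1) - support' (th i)))).
  by apply: eq_bigr => i _; have [_ _ ->] := hst _ (ltn_ord i).
rewrite big_split /= /chain_length big_mkord.
rewrite -(big_mkord xpredT (fun i => support' (th i.+1) - support' (th i))).
by rewrite telescope_sumr // th2 support'_periodicn subrr addr0.
Qed.

End Curve.

(** A minimal chain shows that the set inside [get] is inhabited; two least perimeters coincide. *)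
Lemma min_perimeterE (R : realType) (T : R) (c : R -> R * R) (p q : nat)
    (x : nat -> R) : smooth_strictly_convex_closed T c -> (0 < q)%N ->
    minimal_chain pi (2 * pi * p%:R) (tangent_length (support T c)) q x ->
  min_perimeter c p q = chain_length (tangent_length (support T c)) q x.
Proof.
move=> hc q0 mx; set len := chain_length _ q x.
have lenP : (perimeters c p q `&` lbound (perimeters c p q)) len.
  have hx : circumscribed p q x by exact: chain_closed mx.1.
  split; first by exists x; [exact: hx|rewrite (perimeterE hc q0 hx)].
  by move=> _ [y hy <-]; rewrite (perimeterE hc q0 hy) (minimal_closed q0 mx).
have : (perimeters c p q `&` lbound (perimeters c p q)) (min_perimeter c p q).
  by apply: getPex; exists len.
move=> [m1 m2]; case: lenP => l1 l2.
by apply/eqP; rewrite eq_le m2 // l2.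
Qed.

Theorem mainTheorem5 (R : realType) (T : R) (c : R -> R * R)
    (hc : smooth_strictly_convex_closed T c) (p q : nat)
    (hp : (0 < p)%N) (hq : (0 < q)%N) (hpq : coprime p q)
    (hlt : (2 * p < q - 1)%N) :
  min_perimeter c p (q - 1) + min_perimeter c p (q + 1)
    > 2 * min_perimeter c p q.
Proof.
have [n qn] : exists n, q = n.+1 by exists q.-1; rewrite prednK.
rewrite {q}qn subn1 addn1 /= in hq hpq hlt *.
have dh := support_derive hc; have ph := support_periodic T c.
have h0 := support_gt0 hc; have L0 := tangent_segments_gt0 hc.
have ex m : (2 * p < m)%N -> exists x, minimal_chain pi (2 * pi * p%:R)
    (tangent_length (support T c)) m x by exact: minimal_chain_exists.
have [x mx] := ex n hlt; have [z mz] := ex n.+1 (leqW hlt).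
have [y my] := ex n.+2 (leqW (leqW hlt)).
have n0 : (0 < n)%N by apply: leq_ltn_trans hlt.
rewrite (min_perimeterE hc n0 mx) (min_perimeterE hc _ my) //.
rewrite (min_perimeterE hc _ mz) //.
apply: (minimal_chain_convex (w := pi) (C := 2 * pi * p%:R)) => //.
- by move=> a b; exact: tangent_length_shiftn.
- exact: tangent_length_diag.
- exact: tangent_length_monge dh L0.
- exact: tangent_length_monge_strict dh L0.
- exact: tangent_length_no_corner dh L0.
- by rewrite mulr_gt0 ?ltr0n // mulr_gt0 // pi_gt0.
Qed.
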